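(* There exists exactly one Markov transition kernel $\mu$ on $[0,\infty)$ with $\mu(0,\{0\})=1$ and $\mu(t,[0,t))=1$ for every $t>0$ (absorbing state $0$ and strictly decreasing paths) such that, for every $t>0$, the chain $(X_n)_{n\ge0}$ with $X_0=t$ satisfies $$P\big(\#\{n\ge1: X_n\in(0,t)\}=j\big)=p_j(t)\qquad\text{for all } j\ge0.$$
   Context: $\sigma_1(k,j)$ are the unsigned Stirling numbers of the first kind ($\sigma_1(k,j)=0$ for $k<j$, $\sigma_1(0,0)=1$); $p_j(t)=e^{-t}\sum_{k=j}^\infty \frac{t^k}{k!}\frac{\sigma_1(k,j)}{k!}$ for $j\ge0$ (these form a probability distribution in $j$ for each $t\ge0$). *)

(* Defs.v *)
From HB Require Import structures.
From mathcomp Require Import all_boot all_order all_algebra.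
From mathcomp Require Import all_classical all_reals all_analysis.
Set Implicit Arguments. Unset Strict Implicit. Unset Printing Implicit Defensive.
Import Order.TTheory GRing.Theory Num.Theory.
Import numFieldNormedType.Exports.
Local Open Scope classical_set_scope.
Local Open Scope ring_scope.

Fixpoint stirling1 (n k : nat) : nat :=
  match n, k with
  | 0, 0 => 1
  | 0, _.+1 => 0
  | _.+1, 0 => 0
  | n'.+1, k'.+1 => (n' * stirling1 n' k'.+1 + stirling1 n' k')%N
  end.

Definition pj {R : realType} (j : nat) (t : R) : R :=
  expR (- t) *
  \big[+%R/0%R]_(j <= k <oo) (t ^+ k / (k`!)%:R * ((stirling1 k j)%:R / (k`!)%:R)).

(* Finite-dimensional law of the Markov chain with kernel [k]:
   [cnt_prob k t m j s] = P( #{ 1 <= n <= m : X_n \in (0,t) } = j | X_0 = s ),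
   computed by the Markov property (one-step decomposition). *)
Fixpoint cnt_prob {R : realType} (k : R.-pker R ~> R) (t : R) (m : nat) {struct m}
  : nat -> R -> \bar R :=
  fun j s =>
  match m with
  | 0 => ((j == 0%N)%:R)%:E
  | m'.+1 =>
      (\int[k s]_y (if ((0 < y) && (y < t))%R then
                      match j with 0 => 0%E | j'.+1 => cnt_prob k t m' j' y end
                    else cnt_prob k t m' j y))%E
  end.

Definition good_kernel {R : realType} (k : R.-pker R ~> R) : Prop :=
  k 0 [set 0] = 1%E /\ (forall t : R, 0 < t -> k t [set x : R | 0 <= x < t] = 1%E).

(* For every t > 0 and j, P(#{n >= 1 : X_n in (0,t)} = j | X_0 = t) = p_j(t),
   where the probability of the (infinite-horizon) count event is the limit
   of the probabilities of the truncated counts (monotone in m). *)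
Definition count_law {R : realType} (k : R.-pker R ~> R) : Prop :=
  forall (t : R), 0 < t -> forall j : nat,
    (fun m => cnt_prob k t m j t) @ \oo --> (pj j t)%:E.

(* Main.v *)
(* Let P_j be the power series with coefficients sigma_1(k,j)/k!^2, so that
   p_j(t) = e^-t P_j(t).  As paths are strictly decreasing, the Markov property
   at the first step shows that the count law holds iff, for all t > 0,
     mu(t,{0}) = p_0(t)  and  int_(0,t) p_j dmu(t,.) = p_(j+1)(t)  for all j.

   Existence: with r, v independent and uniform on [0,1], let mu(t,.) be the law
   of r * max(t + ln v, 0).  The recurrence of the Stirling numbers amounts to
   (x e^-x P_(j+1)')' = e^-x P_j, and two applications of the fundamental theorem
   of calculus, in r and then in v, give the equations above.

   Uniqueness: the equations determine the integrals over (0,t) of all the p_j,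
   hence those of sum_j (-n)^j p_j(x).  This series converges boundedly to
   e^-x L_n(x), where L_n is the Laguerre polynomial, because
   sum_j sigma_1(k,j) (-n)^j = (-n)(-n+1)...(-n+k-1) vanishes for k > n.  So the
   integrals of e^-x q(x) are determined for every polynomial q, and so are the
   masses of the intervals (0,a), since 1_(x<a) is a bounded pointwise limit
   of such functions. *)
Require Import Defs.
From HB Require Import structures.
From mathcomp Require Import all_boot all_order all_algebra.
From mathcomp Require Import all_classical all_reals all_analysis.
From mathcomp Require Import measurable_realfun ring zify.
Set Implicit Arguments. Unset Strict Implicit. Unset Printing Implicit Defensive.
Import Order.TTheory GRing.Theory Num.Theory.
Import numFieldNormedType.Exports.
Local Open Scope classical_set_scope.
Local Open Scope ring_scope.

(** * Stirling numbers and the power series of the count law *)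

Lemma stirling1_small k j : (k < j)%N -> stirling1 k j = 0%N.
Proof.
elim: k j => [|k IH] [|j]//= kj.
by rewrite !IH ?muln0// ltnW.
Qed.

Lemma stirling1SS k j :
  stirling1 k.+1 j.+1 = (k * stirling1 k j.+1 + stirling1 k j)%N.
Proof. by []. Qed.

Lemma leq_stirling1_fact k j : (stirling1 k j <= k`!)%N.
Proof.
elim: k j => [|k IH] [|j]//=.
by rewrite factS mulSn addnC leq_add// leq_mul.
Qed.

(** The recurrence multiplies the generating polynomial of row [k] by [z + k]. Row [k] stops at
    [j = k], so every cut-off [J > k] gives the full sum. *)
Lemma stirling1_rising (R : comPzRingType) (z : R) k J : (k < J)%N ->
  \sum_(j < J) (stirling1 k j)%:R * z ^+ j = \prod_(i < k) (z + i%:R).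
Proof.
elim: k J => [|k IH] [|J]// kJ.
  rewrite big_ord_recl big_ord0 big1 ?addr0 ?mul1r// => i _.
  by rewrite /= mul0r.
(* Removing [j = 0] leaves two copies of row [k], one cut at [J] and one, weighted by [k], cut at
   [J.+1]; both are complete. *)
have IH1 := IH J.+1 (leqW kJ); rewrite [RHS]big_ord_recr/=.
rewrite big_ord_recl/= mul0r add0r mulrDr [X in _ = _ + X]mulrC.
rewrite -{1}(IH J kJ) -IH1 [in RHS]big_ord_recl/= expr0 mulr1 mulrDr -natrM.
have -> : (k * stirling1 k 0)%N = 0%N by case: (k) => [|n]; rewrite ?muln0.
rewrite add0r mulr_suml mulr_sumr -big_split/=; apply: eq_bigr => i _.
by rewrite natrD natrM /bump/= !add1n exprS; ring.
Qed.

(** * Power series dominated by the exponential series *)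

Section power_series.
Context {R : realType}.
Implicit Types (c : R^nat) (x y : R).

(** Comparison with the exponential series gives convergence on the whole line. The condition passes
    to the derived coefficients because [(k+1)/(k+1)! = 1/k!], so it covers derivatives of every
    order. *)
Definition fact_dominated c := forall k, `|c k| <= (k`!%:R)^-1.

Lemma is_cvg_pseries_fact_dominated c x :
  fact_dominated c -> cvgn (pseries c x).
Proof.
move=> cd; apply: normed_cvg.
apply: (@series_le_cvg _ _ (exp_coeff `|x|)) => [n|n|n|] /=; first by [].
- by rewrite /exp_coeff/= divr_ge0// exprn_ge0.
- rewrite normrM normrX mulrC; apply: ler_wpM2l; last exact: cd.
  by rewrite exprn_ge0.
- exact: is_cvg_series_exp_coeff.
Qed.

Lemma fact_dominated_diffs c :
  fact_dominated c -> fact_dominated (pseries_diffs c).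
Proof.
move=> cd k; rewrite /pseries_diffs normrM ger0_norm//.
by rewrite mulrC -ler_pdivlMr// (le_trans (cd _))// factS natrM invfM mulrC.
Qed.

Lemma is_derive_fact_dominated c x : fact_dominated c ->
  is_derive x 1 (fun x => limn (pseries c x))
    (limn (pseries (pseries_diffs c) x)).
Proof.
move=> cd; have dd := fact_dominated_diffs cd.
apply: (@pseries_snd_diffs _ _ (`|x| + 1)).
- exact: is_cvg_pseries_fact_dominated.
- exact: is_cvg_pseries_fact_dominated.
- exact/is_cvg_pseries_fact_dominated/fact_dominated_diffs.
- by rewrite [ltRHS]ger0_norm ?addr_ge0// ltrDl.
Qed.

(** Writing [x P'] and [x P''] as power series in this way lets a differential equation be checked
    coefficient by coefficient. *)
Lemma cvg_mulX_pseries c x : cvgn (pseries c x) ->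
  pseries (fun k => if k is k'.+1 then c k' else 0) x @ \oo
    --> x * limn (pseries c x).
Proof.
move=> cv; rewrite -(cvg_shiftS _).
have -> : (fun n => pseries (fun k => if k is k'.+1 then c k' else 0) x n.+1) =
          (fun n => x * pseries c x n).
  apply/funext => n; rewrite /pseries/series/= big_nat_recl//= mul0r add0r.
  by rewrite mulr_sumr; apply: eq_bigr => i _; rewrite exprS; ring.
by apply: cvgM; [exact: cvg_cst|exact: cv].
Qed.

Lemma pseries0 c : limn (pseries c 0) = c 0%N.
Proof.
apply: cvg_lim => //; rewrite -(cvg_shiftS _).
have -> : (fun n => pseries c 0 n.+1) = cst (c 0%N).
  apply/funext => n; rewrite /pseries/series/= big_nat_recl//= expr0 mulr1.
  by rewrite big1 ?addr0// => i _; rewrite expr0n mulr0.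
exact: cvg_cst.
Qed.

Lemma pseries_ge0 c x : 0 <= x -> (forall k, 0 <= c k) ->
  cvgn (pseries c x) -> 0 <= limn (pseries c x).
Proof.
move=> x0 c0 cv; apply: limr_ge => //; apply: nearW => n.
by rewrite /pseries/series/= sumr_ge0// => i _; rewrite mulr_ge0// exprn_ge0.
Qed.

End power_series.

(** * The series [P_j]: differential equation and bounds *)

Section count_series.
Context {R : realType}.
Implicit Types (j k n : nat) (x y t : R).

Definition pj_coef j k : R := (stirling1 k j)%:R / (k`!%:R * k`!%:R).

Definition Pj j x : R := limn (pseries (pj_coef j) x).

Definition dPj j x : R := limn (pseries (pseries_diffs (pj_coef j)) x).

Lemma pj_coef_ge0 j k : 0 <= pj_coef j k.
Proof. by rewrite divr_ge0// mulr_ge0. Qed.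

Lemma pj_coef_fact_dominated j : fact_dominated (pj_coef j).
Proof.
move=> k; rewrite ger0_norm ?pj_coef_ge0// /pj_coef invfM mulrA.
rewrite ler_piMl ?invr_ge0// ler_pdivrMr ?ltr0n ?fact_gt0// mul1r.
by rewrite ler_nat leq_stirling1_fact.
Qed.

Lemma is_cvg_Pj j x : cvgn (pseries (pj_coef j) x).
Proof. exact/is_cvg_pseries_fact_dominated/pj_coef_fact_dominated. Qed.

Lemma pjE j t : pj j t = expR (- t) * Pj j t.
Proof.
rewrite /pj; congr (_ * _); apply: cvg_lim => //.
rewrite (_ : (fun n => _) = pseries (pj_coef j) t); first exact: is_cvg_Pj.
apply/funext => n; rewrite /pseries/series/=.
have E k : t ^+ k / k`!%:R * ((stirling1 k j)%:R / k`!%:R) =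
    pj_coef j k * t ^+ k by rewrite /pj_coef invfM; ring.
under eq_bigr do rewrite E.
(* [pj] sums from [k = j]; the coefficients below [j] vanish, so partial sums from 0 agree with it,
   also when [n] has not reached [j]. *)
have [jn|nj] := leqP j n.
  rewrite [RHS](@big_cat_nat _ _ _ j)//= [X in _ = X + _]big_nat_cond.
  rewrite [X in _ = X + _]big1 ?add0r//.
  by move=> i /[!andbT]/= ij; rewrite /pj_coef stirling1_small// !mul0r.
rewrite big_geq ?(ltnW nj)// big_nat_cond big1// => i /[!andbT]/= ij.
by rewrite /pj_coef stirling1_small ?mul0r// (ltn_trans ij).
Qed.

#[local] Instance is_derive_Pj j x : is_derive x 1 (Pj j) (dPj j x).
Proof. exact/is_derive_fact_dominated/pj_coef_fact_dominated. Qed.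

(** The Stirling recurrence divided by [k!^2], grouped as the coefficients of [x^k] in [(x P')'] and
    in [x P'] for [P = Pj j.+1]. *)
Lemma pj_coef_rec j k : pj_coef j k =
  k.+1%:R * (k.+1%:R * pj_coef j.+1 k.+1) - k%:R * pj_coef j.+1 k.
Proof.
rewrite /pj_coef stirling1SS factS natrD !natrM.
have : (k`!%:R : R) != 0 by rewrite pnatr_eq0 -lt0n fact_gt0.
have : (k.+1%:R : R) != 0 by rewrite pnatr_eq0.
move: (stirling1 k j.+1)%:R (stirling1 k j)%:R (k`!%:R) (k.+1%:R) (k%:R).
by move=> a b f s r s0 f0; field; apply/andP.
Qed.

(* The recurrence of the Stirling numbers is the differential equation
   x P'' + (1 - x) P' = Q between the consecutive series P = Pj j.+1, Q = Pj j. *)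
Lemma is_derive_mul_expN_dPj j x :
  is_derive x 1 (fun x => x * (expR (- x) * dPj j.+1 x))
    (expR (- x) * Pj j x).
Proof.
pose c := pj_coef j.+1.
have dc : fact_dominated (pseries_diffs c).
  exact/fact_dominated_diffs/pj_coef_fact_dominated.
have dd : is_derive x 1 (dPj j.+1)
    (limn (pseries (pseries_diffs (pseries_diffs c)) x)).
  exact: is_derive_fact_dominated.
have de : is_derive x 1 (fun y : R => expR (- y)) (- expR (- x)).
  rewrite -mulrN1; exact: (is_derive1_comp (is_derive_expR (- x))).
apply: (is_derive_eq (is_deriveM (is_derive_id x 1) (is_deriveM de dd))).
rewrite /GRing.scale/= !mulr1.
(* By the product rule the derivative is [e^-x (P' - x P' + x P'')] with [P = Pj j.+1]; an identity
   of power series remains. *)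
suff : Pj j x = x * limn (pseries (pseries_diffs (pseries_diffs c)) x)
   + dPj j.+1 x - x * dPj j.+1 x.
  by move=> ->; rewrite -[(_ * dPj _) x]/(expR (- x) * dPj j.+1 x); ring.
apply: cvg_lim => //.
have cd := is_cvg_pseries_fact_dominated (x := x) dc.
have cdd := is_cvg_pseries_fact_dominated (x := x) (fact_dominated_diffs dc).
pose mulX (a : R^nat) k := if k is k'.+1 then a k' else 0.
rewrite (_ : pseries _ x = (fun n =>
    pseries (mulX (pseries_diffs (pseries_diffs c))) x n
    + pseries (pseries_diffs c) x n - pseries (mulX (pseries_diffs c)) x n)).
  by apply: cvgB; [apply: cvgD; [exact: cvg_mulX_pseries|exact: cd]
                  |exact: cvg_mulX_pseries].
apply/funext => n.
rewrite /pseries/series/= -big_split -sumrB/=; apply: eq_bigr => -[|i] _ /=.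
  rewrite expr0 !mulr1 subr0 add0r (pj_coef_rec j 0) /pseries_diffs -/c.
  by rewrite mul0r subr0 mul1r.
rewrite -mulrDl -mulrBl; congr (_ * _).
rewrite (pj_coef_rec j i.+1) -/c /pseries_diffs -[i.+2]addn1 natrD.
by move: (c _) (c _) => u v; ring.
Qed.

Lemma Pj_le_expR j x : 0 <= x -> Pj j x <= expR x.
Proof.
move=> x0; rewrite expRE; apply: lim_series_le => [||k].
- exact: is_cvg_Pj.
- by rewrite -exp_coeffE; exact: is_cvg_series_exp_coeff.
- apply: ler_wpM2r; first exact: exprn_ge0.
  exact: le_trans (ler_norm _) (pj_coef_fact_dominated j k).
Qed.

Lemma pj_ge0 j x : 0 <= x -> 0 <= pj j x.
Proof.
move=> x0; rewrite pjE mulr_ge0 ?expR_ge0//.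
by apply: pseries_ge0 => //; [exact: pj_coef_ge0|exact: is_cvg_Pj].
Qed.

Lemma pj_le1 j x : 0 <= x -> pj j x <= 1.
Proof.
by move=> x0; rewrite pjE expRN mulrC ler_pdivrMr ?expR_gt0// mul1r Pj_le_expR.
Qed.

Lemma pj0E x : pj 0 x = expR (- x).
Proof.
rewrite pjE (_ : Pj 0 x = 1) ?mulr1//; apply: cvg_lim => //.
rewrite -(cvg_shiftS _) (_ : (fun n => _) = cst 1); first exact: cvg_cst.
apply/funext => n; rewrite /pseries/series/= big_nat_recl//= big1 => [|i _].
  by rewrite addr0 expr0 mulr1 /pj_coef fact0 mulr1 divr1.
by rewrite /pj_coef/= !mul0r.
Qed.

Lemma Pj_at0 j : Pj j.+1 0 = 0.
Proof. by rewrite /Pj pseries0 /pj_coef mul0r. Qed.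

Lemma continuous_Pj j : continuous (Pj j).
Proof.
move=> x; apply/differentiable_continuous/derivable1_diffP.
by have [] := is_derive_Pj j x.
Qed.

Lemma continuous_dPj j : continuous (dPj j).
Proof.
move=> x; apply/differentiable_continuous/derivable1_diffP.
have := is_derive_fact_dominated x
  (fact_dominated_diffs (pj_coef_fact_dominated j)).
by case.
Qed.

Lemma continuous_expRN : continuous (fun x : R => expR (- x)).
Proof.
by move=> x; apply: continuous_comp; [exact: opp_continuous|exact: continuous_expR].
Qed.

Lemma continuous_pj j : continuous (@pj R j).
Proof.
rewrite (_ : pj j = fun x => expR (- x) * Pj j x); last first.
  by apply/funext => x; rewrite pjE.
by move=> x; apply: cvgM; [exact: continuous_expRN|exact: continuous_Pj].
Qed.

Lemma measurable_pj j : measurable_fun setT (@pj R j).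
Proof. exact: continuous_measurable_fun (@continuous_pj j). Qed.

(** * Alternating sums of the [p_j] and Laguerre polynomials *)

Definition rising_neg n k : R := \prod_(i < k) (- n%:R + i%:R).

(** As [rising_neg n k / k!] is [(-1)^k] times the binomial coefficient of [n] over [k], this is the
    usual Laguerre polynomial. *)
Definition laguerre n x : R :=
  \sum_(k < n.+1) rising_neg n k / (k`!%:R * k`!%:R) * x ^+ k.

Lemma rising_neg_eq0 n k : (n < k)%N -> rising_neg n k = 0.
Proof.
move=> nk; rewrite /rising_neg (bigD1 (Ordinal nk))//=.
by rewrite addNr mul0r.
Qed.

Lemma rising_neg_neq0 n : rising_neg n n != 0.
Proof.
by apply/prodf_neq0 => i _; rewrite addrC subr_eq0 eqr_nat neq_ltn ltn_ord.
Qed.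

(** The triangle inequality turns [-n] into [n], and the row polynomial at [n] is
    [n (n+1) ... (n+k-1)], whose factors satisfy [n + i <= (n+1)(i+1)]. *)
Lemma norm_alternating_stirling1 n J k :
  `|\sum_(j < J) (stirling1 k j)%:R * (- n%:R : R) ^+ j|
    <= n.+1%:R ^+ k * k`!%:R.
Proof.
apply: (le_trans (ler_norm_sum _ _ _)).
(* Adding [k+1] nonnegative terms makes the sum long enough for [stirling1_rising], whatever [J]
   is. *)
apply: (@le_trans _ _ (\sum_(j < J + k.+1) (stirling1 k j)%:R * n%:R ^+ j)).
  rewrite big_split_ord/= -[leLHS]addr0 lerD ?sumr_ge0//.
  apply: ler_sum => i _.
  by rewrite normrM normrX normrN !ger0_norm.
rewrite stirling1_rising ?ltn_addl//.
elim: k => [|k IH]; first by rewrite big_ord0 expr0 mul1r.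
rewrite big_ord_recr/= factS exprS natrM.
rewrite [leRHS](_ : _ = (n.+1%:R ^+ k * k`!%:R) * (n.+1%:R * k.+1%:R)); last by ring.
rewrite ler_pM//; first by rewrite prodr_ge0// => i _; rewrite addr_ge0.
by rewrite -natrM -natrD ler_nat; lia.
Qed.

(** The coefficient of [x^k] in the difference vanishes for [k < J], where the cut row is complete
    and sums to [rising_neg n k]; in general it is at most [2 (n+1)^k / k!]. What remains is a tail
    of the exponential series at [(n+1) x]. *)
Lemma alternating_Pj_laguerre n J x : 0 <= x ->
  `|\sum_(j < J) (- n%:R) ^+ j * Pj j x - laguerre n x|
    <= 2 * (expR (n.+1%:R * x) - series (exp_coeff (n.+1%:R * x)) J).
Proof.
move=> x0; set X := _ * x.
pose b k : R := \sum_(j < J) (stirling1 k j)%:R * (- n%:R) ^+ j.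
pose d k := (b k - rising_neg n k) / (k`!%:R * k`!%:R) * x ^+ k.
have X0 : 0 <= X by rewrite mulr_ge0.
have d_small k : (k < J)%N -> d k = 0.
  by move=> kJ; rewrite /d /b stirling1_rising// subrr !mul0r.
have d_le k : `|d k| <= 2 * exp_coeff X k.
  have fk : 0 < k`!%:R :> R by rewrite ltr0n fact_gt0.
  rewrite /d /exp_coeff/= /X exprMn normrM [`|x ^+ k|]ger0_norm ?exprn_ge0//.
  rewrite [leRHS](_ : _ = 2 * (n.+1%:R ^+ k / k`!%:R) * x ^+ k); last by ring.
  apply: ler_wpM2r.
    exact: exprn_ge0.
  rewrite normrM [`|_^-1|]ger0_norm ?invr_ge0 ?mulr_ge0//.
  rewrite invfM !mulrA; apply: ler_wpM2r; first by rewrite invr_ge0 ltW.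
  rewrite ler_pdivrMr// mulr_natl mulr2n mulrDl (le_trans (ler_normB _ _))//.
  rewrite lerD ?norm_alternating_stirling1//.
  by rewrite /rising_neg -(stirling1_rising _ (ltnSn k)) norm_alternating_stirling1.
have cd : series d @ \oo --> \sum_(j < J) (- n%:R) ^+ j * Pj j x - laguerre n x.
  rewrite (_ : series d = (fun N =>
      \sum_(j < J) (- n%:R) ^+ j * pseries (pj_coef j) x N -
      \sum_(0 <= k < N) rising_neg n k / (k`!%:R * k`!%:R) * x ^+ k)); last first.
    apply/funext => N; rewrite /series/= /d.
    under eq_bigr do rewrite !mulrBl.
    rewrite sumrB; congr (_ - _).
    under [RHS]eq_bigr do rewrite /pseries/series/= mulr_sumr.
    rewrite [RHS]exchange_big/=; apply: eq_bigr => k _.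
    rewrite /b !mulr_suml; apply: eq_bigr => i _.
    by rewrite /pj_coef; ring.
  apply: cvgB.
    apply: (@cvg_big _ _ +%R) => [|i _]; first exact: add_continuous.
    apply: cvgM; first exact: cvg_cst.
    exact: is_cvg_Pj.
  (* The Laguerre partial sums are constant once [N > n], since [rising_neg n k] vanishes for
     [k > n]. *)
  apply: cvg_near_cst.
  near=> N; rewrite /laguerre -(big_mkord xpredT
    (fun k => rising_neg n k / (k`!%:R * k`!%:R) * x ^+ k)).
  rewrite (@big_cat_nat _ _ _ n.+1)//=; last by near: N; exact: nbhs_infty_ge.
  rewrite [X in _ + X]big_nat_cond [X in _ + X]big1 ?addr0// => k.
  by rewrite andbT => /andP[nk _]; rewrite rising_neg_eq0// !mul0r.
have cn : (fun N => `|series d N|) @ \oo -->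
    `|\sum_(j < J) (- n%:R) ^+ j * Pj j x - laguerre n x| by exact: cvg_norm cd.
rewrite -(cvg_lim _ cn)//; apply: limr_le; first by apply/cvg_ex; eexists; exact: cn.
near=> N.
have JN : (J <= N)%N by near: N; exact: nbhs_infty_ge.
rewrite /series/= (@big_cat_nat _ _ _ J)//= [X in `|X + _|]big_nat_cond.
rewrite [X in `|X + _|]big1 ?add0r; last first.
  by move=> k; rewrite andbT => /= kJ; rewrite d_small.
rewrite (le_trans (ler_norm_sum _ _ _))//.
apply: (@le_trans _ _ (\sum_(J <= k < N) 2 * exp_coeff X k)).
  exact: ler_sum.
rewrite -mulr_sumr ler_wpM2l// lerBrDl.
rewrite -(@big_cat_nat _ _ _ J 0 N)//=.
have := @nondecreasing_cvgn_le _ (series (exp_coeff X)) _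
  (is_cvg_series_exp_coeff X) N.
apply; apply/nondecreasing_seqP => m; rewrite /series/= big_nat_recr//= lerDl.
by rewrite /exp_coeff/= divr_ge0// exprn_ge0.
Unshelve. all: by end_near. Qed.

Lemma cvg_alternating_pj n x : 0 <= x ->
  (fun J => \sum_(j < J) (- n%:R) ^+ j * pj j x) @ \oo -->
  expR (- x) * laguerre n x.
Proof.
move=> x0; set X := n.+1%:R * x.
rewrite (_ : (fun J => _) = (fun J => expR (- x) *
    \sum_(j < J) (- n%:R) ^+ j * Pj j x)); last first.
  apply/funext => J; rewrite mulr_sumr; apply: eq_bigr => j _.
  by rewrite pjE; ring.
apply: cvgM; first exact: cvg_cst.
have c0 : (fun J => 2 * (expR X - series (exp_coeff X) J)) @ \oo --> (0 : R).
  rewrite -(mulr0 2) -(subrr (expR X)).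
  apply: cvgM; first exact: cvg_cst.
  by apply: cvgB; [exact: cvg_cst|exact: is_cvg_series_exp_coeff].
apply/cvgrPdist_le => e e0; near=> J; rewrite distrC.
apply: le_trans (alternating_Pj_laguerre n J x0) _; near: J.
exact: (cvgr_le _ c0).
Unshelve. all: by end_near. Qed.

(** Being uniform in [J], this provides the constant for dominated convergence on [(0,t)]. *)
Lemma norm_alternating_pj n J x : 0 <= x ->
  `|\sum_(j < J) (- n%:R) ^+ j * pj j x - expR (- x) * laguerre n x| <=
  2 * expR (n.+1%:R * x).
Proof.
move=> x0.
rewrite (_ : _ - _ = expR (- x) *
    (\sum_(j < J) (- n%:R) ^+ j * Pj j x - laguerre n x)); last first.
  rewrite [RHS]mulrBr [X in _ = X - _]mulr_sumr; congr (_ - _); apply: eq_bigr => j _.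
  by rewrite pjE; ring.
rewrite normrM ger0_norm ?expR_ge0// -[leRHS]mul1r ler_pM//.
- by rewrite -expR0 ler_expR oppr_le0.
- apply: (le_trans (alternating_Pj_laguerre n J x0)).
  rewrite ler_wpM2l// gerBl sumr_ge0// => k _.
  by rewrite /exp_coeff/= divr_ge0// exprn_ge0// mulr_ge0.
Qed.

End count_series.

(** * First-step equations *)

Section count_law_equations.
Context {R : realType}.
Local Open Scope ereal_scope.

(** The complement of [B] is null. With [B] carrying the law of the next state, integrands need to
    be compared only there. *)
Lemma integral_eq_full d (T : measurableType d) (m : {measure set T -> \bar R})
    (B : set T) (f g : T -> \bar R) :
  m setT = 1 -> measurable B -> m B = 1 ->
  measurable_fun setT f -> measurable_fun setT g ->
  (forall x, B x -> f x = g x) -> \int[m]_x f x = \int[m]_x g x.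
Proof.
move=> mT mB B1 mf mg fg; apply: ae_eq_integral => //.
exists (~` B); split; first exact: measurableC.
  have : 1 = 1 + m (~` B).
    rewrite -{1}mT -{1}B1 -measureU ?setUCr ?setICr//; exact: measurableC.
  have := measure_ge0 m (~` B); case: (m (~` B)) => [r|//|//] /=.
  by rewrite -EFinD => _ [] /eqP; rewrite addrC -subr_eq subrr eq_sym => /eqP ->.
by move=> x /= nfg Bx; apply: nfg => _; exact: fg.
Qed.

Variable k : R.-pker R ~> R.

Let kT s : k s setT = 1. Proof. exact: prob_kernel. Qed.

Let m0t (t : R) : measurable_fun [set: R] (fun y : R => (0 < y) && (y < t))%R.
Proof. by apply: measurable_and; apply: measurable_fun_ltr. Qed.

Lemma cnt_prob_ge0 t m j s : 0 <= cnt_prob k t m j s.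
Proof.
elim: m j s => [|m IH] j s /=; first by rewrite lee_fin ler0n.
by apply: integral_ge0 => y _; case: ifP => // _; case: j.
Qed.

Lemma measurable_cnt_prob t m j : measurable_fun setT (cnt_prob k t m j).
Proof.
elim: m j => [|m IH] j /=; first exact: measurable_cst.
apply: measurable_fun_integral_kernel.
- by move=> U mU; exact: measurable_kernel.
- move=> y; case: ifP => _; last exact: cnt_prob_ge0.
  by case: j => // j; exact: cnt_prob_ge0.
- by apply: measurable_fun_ifT => //; case: j.
Qed.

Lemma cnt_prob_le1 t m j s : cnt_prob k t m j s <= 1.
Proof.
elim: m j s => [|m IH] j s /=; first by rewrite lee_fin lern1 leq_b1.
rewrite -(mul1e 1) -[X in _ <= _ * X](kT s) -integral_cst//.
apply: ge0_le_integral => //.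
- move=> y _; case: ifP => _; last exact: cnt_prob_ge0.
  by case: j => // j; exact: cnt_prob_ge0.
- apply: measurable_fun_ifT => //; last exact: measurable_cnt_prob.
  by case: j => // j; exact: measurable_cnt_prob.
- by move=> y _; case: ifP => // _; case: j.
Qed.

Let measurable_step t m j : measurable_fun [set: R]
  (fun y => if ((0 < y) && (y < t))%R then
     match j with 0 => 0 | j'.+1 => cnt_prob k t m j' y end
   else cnt_prob k t m j y).
Proof.
apply: measurable_fun_ifT => //; last exact: measurable_cnt_prob.
by case: j => // j; exact: measurable_cnt_prob.
Qed.

Hypothesis gk : good_kernel k.

Let m_co (t : R) : measurable [set x : R | (0 <= x < t)%R].
Proof.
rewrite (_ : [set x | _] = [set` `[0%R, t[]); first exact: measurable_itv.
by apply/seteqP; split => x /=; rewrite in_itv.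
Qed.

Lemma cnt_prob_at0 t m j : cnt_prob k t m j 0%R = ((j == 0%N)%:R)%:E.
Proof.
elim: m j => [//|m IH] j /=.
rewrite (@integral_eq_full _ _ (k 0%R) [set 0%R] _ (cst ((j == 0%N)%:R)%:E)) //.
- by rewrite integral_cst// [X in _ * X]kT mule1.
- exact: gk.1.
- by move=> y ->; rewrite ltxx/=.
Qed.

(** From [s] the chain stays below [s], so raising the threshold from [s] to [t] changes no
    count. *)
Lemma cnt_prob_threshold m j s t : (0 < s)%R -> (s <= t)%R ->
  cnt_prob k t m j s = cnt_prob k s m j s.
Proof.
elim: m j s t => [//|m IH] j s t s0 st /=.
apply: (@integral_eq_full _ _ _ [set x | (0 <= x < s)%R]) => //.
  exact: gk.2.
move=> y /= /andP[y0 ys].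
rewrite ys (lt_le_trans ys st) !andbT.
move: y0; rewrite le_eqVlt => /predU1P[<-|y0].
  by rewrite ltxx !cnt_prob_at0.
rewrite y0; case: j => // j.
(* Both sides are reduced to the threshold [y], the new starting state. *)
by rewrite (IH _ y t)// ?(IH _ y s)// ltW// (lt_le_trans ys).
Qed.

(** A first step into [(0,t)] is itself counted, so the count is 0 exactly when the chain jumps to 0
    at once, whatever the horizon. *)
Lemma cnt_probS0 t m : (0 < t)%R -> cnt_prob k t m.+1 0 t = k t [set 0%R].
Proof.
move=> t0 /=.
rewrite (@integral_eq_full _ _ _ [set x | (0 <= x < t)%R] _
  (fun y => (\1_[set 0%R] y)%:E)) //; first by rewrite integral_indic// setIT.
- exact: gk.2.
- exact: (measurable_step t m 0).
- exact/measurable_EFinP/measurable_indic.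
- move=> y /= /andP[y0 yt]; rewrite yt andbT indicE.
  move: y0; rewrite le_eqVlt => /predU1P[<-|y0].
    by rewrite ltxx cnt_prob_at0 mem_set.
  by rewrite y0 memNset//=; apply/eqP; rewrite gt_eqF.
Qed.

Lemma cnt_probSS t m j : (0 < t)%R ->
  cnt_prob k t m.+1 j.+1 t = \int[k t]_(y in `]0%R, t[) cnt_prob k t m j y.
Proof.
move=> t0; rewrite [RHS]integral_mkcond/=.
apply: (@integral_eq_full _ _ _ [set x | (0 <= x < t)%R]) => //.
- exact: gk.2.
- exact: (measurable_step t m j.+1).
- apply/(measurable_restrictT _ _).1 => //.
  by apply: measurable_funTS; exact: measurable_cnt_prob.
- move=> y /= /andP[y0 yt]; rewrite patchE mem_setE in_itv/= yt andbT.
  move: y0; rewrite le_eqVlt => /predU1P[<-|y0].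
    by rewrite ltxx cnt_prob_at0.
  by rewrite y0.
Qed.

Lemma cvg_cnt_probSS t j : (0 < t)%R ->
  (forall y : R, (0 < y < t)%R ->
     (fun m => cnt_prob k y m j y) @ \oo --> (pj j y)%:E) ->
  (fun m => cnt_prob k t m j.+1 t) @ \oo -->
    \int[k t]_(y in `]0%R, t[) (pj j y)%:E.
Proof.
move=> t0 cy; rewrite -(cvg_shiftS _).
rewrite (_ : (fun m => _) =
  (fun m => \int[k t]_(y in `]0%R, t[) cnt_prob k t m j y)); last first.
  by apply/funext => m; exact: cnt_probSS.
have [] // := @dominated_convergence _ _ _ (k t) `]0%R, t[ (measurable_itv _)
  (fun m => cnt_prob k t m j) (fun y => (pj j y)%:E) (cst 1).
- by move=> m; apply: measurable_funTS; exact: measurable_cnt_prob.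
- by apply/measurable_EFinP/measurable_funTS; exact: measurable_pj.
- apply: aeW => y /=; rewrite in_itv/= => /andP[y0 yt].
  (* Convergence is assumed only for a threshold equal to the starting state. *)
  rewrite (_ : (fun m => _) = (fun m => cnt_prob k y m j y)).
    by apply: cy; rewrite y0.
  by apply/funext => m; apply: cnt_prob_threshold => //; exact: ltW.
- apply/integrableP; split; first exact: measurable_cst.
  rewrite (eq_integral (cst 1)) => [|y _]; last by rewrite /= normr1.
  rewrite integral_cst// mul1e.
  apply: (@le_lt_trans _ _ (k t setT)); first by apply: le_measure; rewrite ?inE.
  by rewrite kT ltry.
- apply: aeW => y m _ /=.
  by rewrite gee0_abs ?cnt_prob_ge0// cnt_prob_le1.
Qed.

(** The limit in [m] passes under the first-step integral. Conversely, induction on [j], for all [t]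
    at once, recovers the law, each level using the previous one at smaller states. *)
Lemma count_lawP : count_law k <-> forall t : R, (0 < t)%R ->
  k t [set 0%R] = (pj 0 t)%:E /\
  forall j, \int[k t]_(y in `]0%R, t[) (pj j y)%:E = (pj j.+1 t)%:E.
Proof.
have c0 t : (0 < t)%R -> (fun m => cnt_prob k t m 0 t) @ \oo --> k t [set 0%R].
  move=> t0; rewrite -(cvg_shiftS _).
  rewrite (_ : (fun m => _) = (fun=> k t [set 0%R])); first exact: cvg_cst.
  by apply/funext => m; exact: cnt_probS0.
split=> [ck t t0|ck t + j].
  split=> [|j].
    by apply: (cvg_unique _ (c0 t t0) (ck t t0 0%N)); exact: ereal_hausdorff.
  apply: (cvg_unique _ _ (ck t t0 j.+1)); first exact: ereal_hausdorff.
  by apply: cvg_cnt_probSS => // y /andP[y0 yt]; exact: ck.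
elim: j t => [|j IH] t t0.
  by rewrite -(ck t t0).1; exact: c0.
rewrite -(ck t t0).2; apply: cvg_cnt_probSS => // y /andP[y0 _]; exact: IH.
Qed.

End count_law_equations.

(** * Existence *)

Section next_state_kernel.
Context {R : realType}.
Local Notation mu := (@lebesgue_measure R).

Lemma FTC_is_derive (F f : R -> R) (a b : R) : a < b ->
  (forall x, a <= x <= b -> is_derive x 1 F (f x)) ->
  (forall x, a <= x <= b -> {for x, continuous f}) ->
  (\int[mu]_(x in `[a, b]) (f x)%:E = (F b)%:E - (F a)%:E)%E.
Proof.
move=> ab dF cf.
have cF x : a <= x <= b -> {for x, continuous F}.
  move=> /dF [dFx _]; exact/differentiable_continuous/derivable1_diffP.
apply: continuous_FTC2 => //.
- apply: continuous_in_subspaceT => x; rewrite inE/= in_itv/=; exact: cf.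
- split.
  + move=> x; rewrite in_itv/= => /andP[ax xb].
    by have [] := dF x; rewrite ?(ltW ax) ?(ltW xb).
  + by apply: cvg_at_right_filter; apply: cF; rewrite lexx ltW.
  + by apply: cvg_at_left_filter; apply: cF; rewrite lexx ltW.
- move=> x; rewrite in_itv/= => /andP[ax xb]; rewrite derive1E.
  have dFx : is_derive x 1 F (f x) by apply: dF; rewrite (ltW ax) (ltW xb).
  exact: derive_val.
Qed.

Local Notation TR := (measurableTypeR R).

(** For uniform [w.2], [- ln w.2] is a standard exponential variable: the state loses an exponential
    amount, is cut off at 0, and is then multiplied by a uniform factor. *)
Definition next_state (t : R) (w : TR * TR) : R := w.1 * Num.max (t + ln w.2) 0.

Lemma measurable_next_state_uncurry :
  measurable_fun setT (fun z : R * (TR * TR) => next_state z.1 z.2).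
Proof.
apply: measurable_funM.
  by apply: (measurableT_comp measurable_fst); exact: measurable_snd.
apply: measurable_maxr => //; apply: measurable_funD; first exact: measurable_fst.
apply: (measurableT_comp (@measurable_ln R)).
by apply: (measurableT_comp measurable_snd); exact: measurable_snd.
Qed.

Lemma measurable_next_state t : measurable_fun [set: TR * TR] (next_state t).
Proof.
apply: measurable_funM; first exact: measurable_fst.
apply: measurable_maxr => //; apply: measurable_funD => //.
by apply: (measurableT_comp (@measurable_ln R)); exact: measurable_snd.
Qed.

Definition U01 : probability TR R := uniform_prob (@ltr01 R).

Lemma integral_U01 (f : TR -> \bar R) :
  measurable_fun setT f -> (forall x, 0 <= f x)%E ->
  (\int[U01]_x f x = \int[mu]_(x in `[0%R, 1%R]) f x)%E.
Proof.
by move=> mf f0; rewrite [LHS]integral_uniform// subr0 invr1 mul1e.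
Qed.

Definition next_law (t : R) : set R -> \bar R :=
  pushforward (U01 \x U01)%E (next_state t).

Section next_law_measure.
Variable t : R.

Let mt := measurable_next_state t.

Let next_law0 : next_law t set0 = 0%E.
Proof. by rewrite /next_law /pushforward preimage_set0 measure0. Qed.

Let next_law_ge0 A : (0 <= next_law t A)%E.
Proof. exact: measure_ge0. Qed.

Let next_law_sigma_additive : semi_sigma_additive (next_law t).
Proof. exact: measure_semi_sigma_additive. Qed.

HB.instance Definition _ := isMeasure.Build _ _ _ (next_law t)
  next_law0 next_law_ge0 next_law_sigma_additive.

End next_law_measure.

Definition next_kernel (t : R) : {measure set R -> \bar R} := next_law t.

Let measurable_next_kernel A : measurable A ->
  measurable_fun [set: R] (next_kernel ^~ A).
Proof.
move=> mA.
have mB : measurable ((fun z : R * (TR * TR) => next_state z.1 z.2) @^-1` A).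
  rewrite -[X in measurable X]setTI; exact: measurable_next_state_uncurry.
have := @measurable_fun_xsection _ _ _ _ _ 
  (product_subprobability (U01 : subprobability TR R, U01 : subprobability TR R)) _ mB.
congr (measurable_fun _ _); apply/funext => t /=.
rewrite /next_law /pushforward; congr (_ _).
by apply/seteqP; split => w; rewrite /xsection/= inE.
Qed.

HB.instance Definition _ := isKernel.Build _ _ _ _ R next_kernel
  measurable_next_kernel.

Let next_kernel_setT t : next_kernel t setT = 1%E.
Proof.
rewrite /next_kernel /= /next_law /pushforward preimage_setT -setXTT product_measure1E//.
by rewrite -[RHS]mule1; congr (_ * _)%E; exact: probability_setT.
Qed.

HB.instance Definition _ := Kernel_isProbability.Build _ _ _ _ R next_kernel
  next_kernel_setT.

(** Tonelli with [r] inside: for fixed [v] the next state is [r] times a constant, and the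
    fundamental theorem is applied in [r] first. *)
Lemma integral_next_kernel t (f : R -> \bar R) :
  measurable_fun setT f -> (forall y, 0 <= f y)%E ->
  (\int[next_kernel t]_y f y =
   \int[mu]_(v in `[0%R, 1%R]) \int[mu]_(r in `[0%R, 1%R])
     f (next_state t (r, v)))%E.
Proof.
move=> mf f0.
have mfn : measurable_fun setT (f \o next_state t).
  exact: (measurableT_comp mf (measurable_next_state t)).
transitivity (\int[(U01 \x U01)%E]_w (f \o next_state t) w)%E.
  have := @ge0_integral_pushforward _ _ _ _ R _ (measurable_next_state t)
    (U01 \x U01)%E setT f measurableT mf (fun y _ => f0 y).
  by rewrite preimage_setT.
transitivity (\int[U01]_v \int[U01]_r (f \o next_state t) (r, v))%E.
  by apply: fubini_tonelli2 => // w; exact: f0.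
have mG := measurable_fun_fubini_tonelli_G (m1 := U01) (f \o next_state t) mfn.
rewrite integral_U01 => [||v]; last 2 first.
- by apply: mG => w; exact: f0.
- by apply: integral_ge0 => r _; exact: f0.
apply: eq_integral => v _; rewrite integral_U01 => [//||r]; last exact: f0.
by apply: (measurableT_comp mfn); exact: measurable_pair2.
Qed.

Lemma next_kernelE t (A : set R) : measurable A ->
  next_kernel t A = (\int[mu]_(v in `[0%R, 1%R]) \int[mu]_(r in `[0%R, 1%R])
     (\1_A (next_state t (r, v)))%:E)%E.
Proof.
move=> mA.
have := @integral_indic _ _ _ (next_kernel t) setT measurableT A mA.
rewrite setIT => <-; apply: integral_next_kernel => [|y]; last by rewrite lee_fin.
exact/measurable_EFinP/measurable_indic.
Qed.

Lemma integral_itv01_cst (c : \bar R) :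
  (\int[mu]_(_ in `[0%R, 1%R]) c = c)%E.
Proof.
by rewrite integral_cst//= lebesgue_measure_itv/= lte01 sube0 mule1.
Qed.

(** The endpoints are null. Dropping them excludes [v = 0], where [ln] has only a default value,
    [r = 0], where the state is always 0, and [r = 1], where the descent may fail to be strict. *)
Lemma eq_integral_itv01 (g f : R -> \bar R) :
  measurable_fun [set: R] g -> (forall r : R, 0 < r < 1 -> f r = g r) ->
  (\int[mu]_(r in `[0%R, 1%R]) f r = \int[mu]_(r in `[0%R, 1%R]) g r)%E.
Proof.
move=> mg fg.
have mg' : measurable_fun (`]0%R, 1%R[%classic : set R) g by exact: measurable_funTS.
rewrite [RHS]integral_itv_bndoo// integral_itv_bndoo.
  by apply: eq_integral => r; rewrite inE/= in_itv/=; exact: fg.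
apply: (eq_measurable_fun g) => // r.
by rewrite inE/= in_itv/= => r01; rewrite fg.
Qed.

Lemma next_kernel_good : good_kernel next_kernel.
Proof.
split=> [|t t0].
  rewrite next_kernelE// -[RHS](integral_itv01_cst 1%E).
  apply: eq_integral_itv01 => // v /andP[v0 v1].
  rewrite -[RHS](integral_itv01_cst 1%E); apply: eq_integral_itv01 => // r _.
  rewrite indicE mem_set//= /next_state/= add0r.
  by rewrite (max_idPr _) ?mulr0// ln_le0// ltW.
have mt : measurable [set x : R | 0 <= x < t].
  rewrite (_ : [set x | _] = [set` `[0%R, t[]); first exact: measurable_itv.
  by apply/seteqP; split => x /=; rewrite in_itv.
rewrite next_kernelE// -[RHS](integral_itv01_cst 1%E).
apply: eq_integral_itv01 => // v /andP[v0 v1].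
rewrite -[RHS](integral_itv01_cst 1%E); apply: eq_integral_itv01 => // r.
move=> /andP[r0 r1].
rewrite indicE mem_set//= /next_state/= mulr_ge0 ?le_max ?lexx ?orbT ?(ltW r0)//=.
have mx : Num.max (t + ln v) 0 <= t.
  by rewrite ge_max (ltW t0) andbT gerDl ln_le0// ltW.
apply: (@le_lt_trans _ _ (r * t)); first by rewrite ler_wpM2l// ltW.
by rewrite gtr_pMl.
Qed.

Lemma next_state_pos t (v : R) : 0 < v ->
  (0 < Num.max (t + ln v) 0) = (expR (- t) < v).
Proof.
by move=> v0; rewrite lt_max ltxx orbF -ltrBlDl sub0r -[v in RHS]lnK ?posrE// ltr_expR.
Qed.

Lemma next_state_eq0 t (v : R) : 0 < v -> v <= expR (- t) ->
  Num.max (t + ln v) 0 = 0.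
Proof.
move=> v0 ve; apply/eqP; rewrite eq_le leNgt next_state_pos// -leNgt ve/=.
by rewrite le_max lexx orbT.
Qed.

(** For [r > 0] the next state is 0 exactly when [v <= e^-t], an event of probability [e^-t]. *)
Lemma next_kernel_set0 t : 0 < t -> next_kernel t [set 0] = (expR (- t))%:E.
Proof.
move=> t0; rewrite next_kernelE//.
have mE : measurable `]0%R, expR (- t)]%classic by exact: measurable_itv.
rewrite (eq_integral_itv01 (g := fun v => (\1_`]0%R, expR (- t)] v)%:E)).
- rewrite integral_indic// setIidl; last first.
    move=> v /=; rewrite !in_itv/= => /andP[/ltW -> ve].
    by rewrite (le_trans ve)// -expR0 ler_expR oppr_le0 ltW.
  by rewrite /= lebesgue_measure_itv/= lte_fin expR_gt0 sube0.
- exact/measurable_EFinP/measurable_indic.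
- move=> v /andP[v0 v1].
  rewrite -[RHS]integral_itv01_cst; apply: eq_integral_itv01 => // r.
  move=> /andP[r0 r1]; have [ev|ve] := ltP (expR (- t)) v.
    rewrite [in RHS]indicE memNset; last first.
      by rewrite /= in_itv/= => /andP[_]; rewrite leNgt ev.
    rewrite indicE memNset// /next_state/=; apply/eqP.
    by rewrite mulf_neq0 ?gt_eqF// next_state_pos.
  rewrite [in RHS]indicE mem_set/=; last by rewrite in_itv/= v0.
  by rewrite indicE mem_set//= /next_state/= next_state_eq0// mulr0.
Qed.

(** [Phi] is a primitive of [pj j] by [is_derive_mul_expN_dPj], so [Phi (r * s) / s] is a primitive
    in [r], and [Phi 0 = 0]. *)
Lemma integral_pj_scale j (s : R) : 0 < s ->
  (\int[mu]_(r in `[0%R, 1%R]) (pj j (r * s))%:E =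
   (expR (- s) * dPj j.+1 s)%:E)%E.
Proof.
move=> s0.
pose Phi (x : R) := x * (expR (- x) * dPj j.+1 x).
pose F (r : R) := s^-1 * Phi (r * s).
transitivity ((F 1)%:E - (F 0)%:E)%E.
  apply: (@FTC_is_derive F (fun r => pj j (r * s)) 0 1 ltr01) => r _.
    have ds : is_derive r 1 (fun r : R => r * s) s.
      apply: (is_derive_eq (is_deriveM (is_derive_id r 1) (is_derive_cst s r 1))).
      by rewrite /GRing.scale/= mulr0 add0r mulr1.
    have dP := @is_derive1_comp _ Phi ( *%R^~ s) r _ _
      (is_derive_mul_expN_dPj j (r * s)) ds.
    apply: (is_derive_eq (is_deriveZ s^-1 dP)).
    by rewrite /GRing.scale/= pjE mulrC mulfK// gt_eqF.
  apply: continuous_comp; last exact: continuous_pj.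
  by apply: cvgM; [exact: cvg_id|exact: cvg_cst].
by rewrite /F mul1r mul0r /Phi mul0r mulr0 sube0 mulKf// gt_eqF.
Qed.

(** As [expR (- (t + ln v)) = e^-t / v], the integrand is the derivative in [v] of
    [e^-t P(t + ln v)] with [P = Pj j.+1]. At the lower end [t + ln v = 0], where [P] vanishes. *)
Lemma integral_dPj_ln j (t : R) : 0 < t ->
  (\int[mu]_(v in `[expR (- t), 1%R])
     (expR (- (t + ln v)) * dPj j.+1 (t + ln v))%:E = (pj j.+1 t)%:E)%E.
Proof.
move=> t0.
have pos v : expR (- t) <= v <= 1 -> 0 < v.
  by move=> /andP[+ _]; apply: lt_le_trans; exact: expR_gt0.
pose F v : R := expR (- t) * Pj j.+1 (t + ln v).
transitivity ((F 1)%:E - (F (expR (- t)))%:E)%E; last first.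
  by rewrite /F ln1 addr0 expRK subrr Pj_at0 mulr0 sube0 pjE.
apply: (@FTC_is_derive F
    (fun v => expR (- (t + ln v)) * dPj j.+1 (t + ln v)))
  => [|v /pos v0|v /pos v0].
- by rewrite expR_lt1 oppr_lt0.
- have dl : is_derive v 1 (fun v : R => t + ln v) v^-1.
    apply: (is_derive_eq (is_deriveD (is_derive_cst t v 1) (is_derive1_ln v0))).
    by rewrite add0r.
  have dP := @is_derive1_comp _ (Pj j.+1) (fun v => t + ln v) v _ _
    (is_derive_Pj j.+1 (t + ln v)) dl.
  apply: (is_derive_eq (is_deriveZ (expR (- t)) dP)).
  by rewrite /GRing.scale/= opprD expRD [expR (- ln v)]expRN lnK//; ring.
- have cl : {for v, continuous (fun v : R => t + ln v)}.
    by apply: cvgD; [exact: cvg_cst|exact: continuous_ln].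
  apply: cvgM.
    exact: (continuous_comp cl (@continuous_expRN R _)).
  exact: (continuous_comp cl (@continuous_dPj R _ _)).
Qed.

Lemma next_kernel_pj t j : 0 < t ->
  (\int[next_kernel t]_(y in `]0%R, t[) (pj j y)%:E = (pj j.+1 t)%:E)%E.
Proof.
move=> t0; rewrite integral_mkcond.
set f := (X in (\int[_]_x X x)%E).
have fE y : f y = if 0 < y < t then (pj j y)%:E else 0%E.
  by rewrite /f/= patchE mem_setE in_itv.
have mf : measurable_fun [set: R] f.
  apply/(measurable_restrictT _ _).1 => //.
  by apply/measurable_EFinP/measurable_funTS; exact: measurable_pj.
have f0 y : (0 <= f y)%E.
  rewrite fE; case: ifP => // /andP[y0 _].
  by rewrite lee_fin pj_ge0// ltW.
rewrite (integral_next_kernel t mf f0).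
pose h v : \bar R := (expR (- (t + ln v)) * dPj j.+1 (t + ln v))%:E.
have mh : measurable_fun [set: R] h.
  have ml : measurable_fun [set: R] (fun v : R => t + ln v).
    by apply: measurable_funD => //; exact: measurable_ln.
  apply/measurable_EFinP/measurable_funM.
    exact: (measurableT_comp (continuous_measurable_fun (@continuous_expRN R)) ml).
  exact: (measurableT_comp (continuous_measurable_fun (@continuous_dPj R j.+1)) ml).
(* The inner integral over [r] is [h v] when [v > e^-t]; otherwise the next state is 0, which lies
   outside [(0,t)]. *)
rewrite (eq_integral_itv01 (g := h \_ `]expR (- t), 1%R])).
- rewrite -integral_mkcondr setIidr; last first.
    move=> v /=; rewrite !in_itv/= => /andP[ev ->].
    by rewrite (le_trans _ (ltW ev))// expR_ge0.
  rewrite integral_itv_obnd_cbnd; last exact: measurable_funTS.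
  exact: integral_dPj_ln.
- by apply/(measurable_restrictT _ _).1 => //; exact: measurable_funTS.
- move=> v /andP[v0 v1]; rewrite patchE mem_setE in_itv/= (ltW v1) andbT.
  case: ifPn => [ev|]; last first.
    rewrite -leNgt => ve; rewrite -[RHS]integral_itv01_cst.
    apply: eq_integral_itv01 => // r _.
    by rewrite fE /next_state/= next_state_eq0// mulr0 ltxx.
  have s0 : 0 < t + ln v.
    by have := next_state_pos t v0; rewrite ev lt_max ltxx orbF.
  rewrite /h -(integral_pj_scale _ s0); apply: eq_integral_itv01.
    apply/measurable_EFinP; apply: (measurableT_comp (@measurable_pj R j)).
    by apply: measurable_funM; [exact: measurable_id|exact: measurable_cst].
  move=> r /andP[r0 r1]; rewrite fE /next_state/= (max_idPl _) ?(ltW s0)//.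
  rewrite mulr_gt0//= (@lt_le_trans _ _ (t + ln v))// ?gtr_pMl//.
  by rewrite gerDl ln_le0// ltW.
Qed.

Lemma next_kernel_count_law : count_law next_kernel.
Proof.
apply/(count_lawP next_kernel_good) => t t0; split.
  by rewrite pj0E next_kernel_set0.
by move=> j; exact: next_kernel_pj.
Qed.

End next_state_kernel.
(** * Uniqueness *)

Section geometric_threshold.
Context {R : realType}.
Implicit Types (x y u a r : R) (n k : nat).

Lemma bernoulli_le x n : 0 <= x -> 1 + n%:R * x <= (1 + x) ^+ n.
Proof.
move=> x0; elim: n => [|n IH]; first by rewrite mul0r addr0 expr0.
have := ler_wpM2r (addr_ge0 ler01 x0) IH.
rewrite exprSr; apply: le_trans.
rewrite -natr1 -subr_ge0 (_ : _ - _ = n%:R * (x * x)); last by ring.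
by rewrite !mulr_ge0.
Qed.

Lemma bernoulli_ge y k : 0 <= y <= 1 -> 1 - k%:R * y <= (1 - y) ^+ k.
Proof.
move=> /andP[y0 y1]; elim: k => [|k IH]; first by rewrite mul0r subr0 expr0.
have := ler_wpM2r (_ : 0 <= 1 - y) IH; rewrite subr_ge0 => /(_ y1).
rewrite exprSr; apply: le_trans.
rewrite -natr1 -subr_ge0 (_ : _ - _ = k%:R * (y * y)); last by ring.
by rewrite !mulr_ge0.
Qed.

(** By Bernoulli, [(1-y)^k (1+ky) <= ((1-y)(1+y))^k = (1-y^2)^k <= 1]. *)
Lemma expr1B_le_inv y k : 0 <= y <= 1 -> (1 - y) ^+ k <= (1 + k%:R * y)^-1.
Proof.
move=> /andP[y0 y1]; have ky : 0 < 1 + k%:R * y by rewrite ltr_pwDl// mulr_ge0.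
rewrite -[leRHS]mul1r ler_pdivlMr//.
have ye : 0 <= (1 - y) ^+ k by rewrite exprn_ge0// subr_ge0.
apply: (le_trans (ler_wpM2l ye (bernoulli_le k y0))).
rewrite -exprMn exprn_ile1//; first by rewrite mulr_ge0 ?subr_ge0// addr_ge0.
rewrite -subr_ge0 (_ : _ - _ = y * y); last by ring.
exact: mulr_ge0.
Qed.

(** With [q] the square root of [r], Bernoulli bounds [n q^n] by a constant, and the remaining
    factor [q^n] tends to 0. *)
Lemma cvg_mulrn_expr r : 0 < r < 1 ->
  (fun n => n%:R * r ^+ n) @ \oo --> (0 : R).
Proof.
move=> /andP[r0 r1]; set q := Num.sqrt r.
have q0 : 0 < q by rewrite sqrtr_gt0.
have q1 : q < 1 by rewrite -sqrtr1 ltr_sqrt.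
have h0 : 0 < q^-1 - 1 by rewrite subr_gt0 invf_gt1.
have cq : (fun n => (q^-1 - 1)^-1 * q ^+ n) @ \oo --> (0 : R).
  by apply: cvg_geometric; rewrite gtr0_norm.
apply: (squeeze_cvgr _ (@cvg_cst _ _ _ _ _) cq).
apply: nearW => n; rewrite mulr_ge0 ?exprn_ge0 ?(ltW r0)//=.
rewrite -[r](sqr_sqrtr (ltW r0)) -/q -exprM mulnC exprM expr2 mulrA.
rewrite ler_wpM2r ?exprn_ge0 ?(ltW q0)//.
rewrite -[leRHS]mul1r ler_pdivlMr// mulrAC -ler_pdivlMr ?exprn_gt0// mul1r.
rewrite -exprVn; have := bernoulli_le n (ltW h0).
rewrite (_ : 1 + (q^-1 - 1) = q^-1); last by ring.
by apply: le_trans; rewrite lerDr.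
Qed.

Definition threshold_exponent a n := Num.truncn (n%:R * a^-1 ^+ n).

(* The exponent grows just faster than a^-n, so that the power tends to 0 at
   u = a as well: no point of continuity is needed in the limit. *)
Lemma cvg_threshold a u : 0 < a < 1 -> 0 < u < 1 ->
  (fun n => (1 - u ^+ n) ^+ threshold_exponent a n) @ \oo
    --> ((u < a)%R%:R : R).
Proof.
move=> /andP[a0 a1] /andP[u0 u1].
have un n : 0 <= u ^+ n <= 1 by rewrite exprn_ge0 ?exprn_ile1// ltW.
have [ua|au] := ltP u a.
  (* For [u < a], Bernoulli bounds the power from below by [1 - n (u/a)^n]. *)
  have cr : (fun n => 1 - n%:R * (u / a) ^+ n) @ \oo --> (1 : R).
    rewrite -[X in _ --> X]subr0; apply: cvgB; first exact: cvg_cst.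
    by apply: cvg_mulrn_expr; rewrite divr_gt0// ltr_pdivrMr// mul1r.
  apply: (squeeze_cvgr _ cr (@cvg_cst _ _ _ _ _)).
  apply: nearW => n; apply/andP; split; last first.
    have /andP[? ?] := un n.
    by rewrite exprn_ile1 ?subr_ge0// gerBl.
  apply: (le_trans _ (bernoulli_ge _ (un n))).
  have /andP[v0 _] := un n.
  rewrite lerB// (_ : n%:R * _ = n%:R * a^-1 ^+ n * u ^+ n); last first.
    by rewrite exprMn mulrCA mulrC.
  rewrite ler_wpM2r//.
  by rewrite truncn_le mulr_ge0// exprn_ge0// invr_ge0 ltW.
(* For [u >= a] and [K] the exponent, the power is at most [1/(1 + K u^n)]. This is at most [1/n],
   because [(K+1) u^n >= n (u/a)^n >= n] and [u^n <= 1]. *)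
have cr : (fun n => n%:R^-1) @ \oo --> (0 : R).
  by rewrite -(cvg_shiftS _); exact: cvg_harmonic.
apply: (squeeze_cvgr _ (@cvg_cst _ _ _ _ _) cr).
near=> n.
have n0 : 0 < n%:R :> R by rewrite ltr0n; near: n; exact: nbhs_infty_gt.
have /andP[v0 v1] := un n.
rewrite exprn_ge0 ?subr_ge0//=.
apply: (le_trans (expr1B_le_inv _ (un n))).
rewrite lef_pV2 ?posrE ?ltr_pwDl ?mulr_ge0//.
have := truncnS_gt (n%:R * a^-1 ^+ n); rewrite -/(threshold_exponent a n) => lt.
apply: (@le_trans _ _ ((threshold_exponent a n).+1%:R * u ^+ n)); last first.
  by rewrite -natr1 mulrDl mul1r addrC lerD2r.
apply: (le_trans _ (ler_wpM2r v0 (ltW lt))).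
rewrite -mulrA -exprMn -[leLHS]mulr1 ler_wpM2l// exprn_ege1//.
by rewrite mulrC ler_pdivlMr// mul1r.
Unshelve. all: by end_near. Qed.

End geometric_threshold.

(** * Functions with equal integrals under two laws *)

Section count_moments.
Context {R : realType}.
Variables (m1 m2 : {measure set R -> \bar R}) (t : R).
Hypotheses (m1T : m1 setT = 1%E) (m2T : m2 setT = 1%E) (t0 : 0 < t).

Let D : set R := `]0, t[%classic.

Let mD : measurable D. Proof. exact: measurable_itv. Qed.

(** The bound is asked on [(0,t)] only, as the weighted polynomials to come need not be bounded on
    the line; it gives integrability, hence linearity. *)
Definition agree_bounded (f : R -> R) (M : R) :=
  [/\ measurable_fun [set: R] f, (forall x, 0 < x < t -> `|f x| <= M) &
      (\int[m1]_(x in D) (f x)%:E = \int[m2]_(x in D) (f x)%:E)%E].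

Definition agree f := exists M, agree_bounded f M.

Let mDoo (m : {measure set R -> \bar R}) : m setT = 1%E -> (m D < +oo)%E.
Proof.
move=> mT; apply: (@le_lt_trans _ _ (m setT)).
  by apply: le_measure; rewrite ?inE.
by rewrite mT ltry.
Qed.

Let integrable_bounded (m : {measure set R -> \bar R}) f M : m setT = 1%E ->
  agree_bounded f M -> m.-integrable D (EFin \o f).
Proof.
move=> mT [mf fM _]; apply: measurable_bounded_integrable => //.
- exact: mDoo.
- exact: measurable_funTS.
- exists M; split; first exact: num_real.
  move=> N MN x; rewrite /D/= in_itv/= => x0t.
  exact: le_trans (fM x x0t) (ltW MN).
Qed.

Lemma agree_linear f g (a b : R) : agree f -> agree g ->
  agree (fun x => a * f x + b * g x).
Proof.
move=> [M fM] [N gN]; exists (`|a| * M + `|b| * N).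
have [mf fl fe] := fM; have [mg gl ge] := gN; split.
- by apply: measurable_funD; apply: measurable_funM.
- move=> x x0t; rewrite (le_trans (ler_normD _ _))// !normrM.
  by rewrite lerD// ler_wpM2l// ?fl ?gl.
- under eq_integral do rewrite EFinD !EFinM.
  under [RHS]eq_integral do rewrite EFinD !EFinM.
  have if1 := integrable_bounded m1T fM; have if2 := integrable_bounded m2T fM.
  have ig1 := integrable_bounded m1T gN; have ig2 := integrable_bounded m2T gN.
  rewrite !integralD//; try exact: integrableZl.
  by rewrite !integralZl// fe ge.
Qed.

Lemma agree0 : agree (fun=> 0).
Proof.
exists 0; split=> //; first by move=> x _; rewrite normr0.
by rewrite !integral0.
Qed.

Lemma agree_sum n (F : 'I_n -> R -> R) : (forall i, agree (F i)) ->
  agree (fun x => \sum_i F i x).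
Proof.
elim: n F => [|n IH] F aF.
  rewrite (_ : (fun x => _) = fun=> 0); first exact: agree0.
  by apply/funext => x; rewrite big_ord0.
rewrite (_ : (fun x => _) = (fun x =>
    1 * F ord0 x + 1 * \sum_i F (lift ord0 i) x)).
  by apply: agree_linear => //; exact: IH.
by apply/funext => x; rewrite big_ord_recl !mul1r.
Qed.

Lemma agreeZ c f : agree f -> agree (fun x => c * f x).
Proof.
move=> af; have := agree_linear c 0 af agree0.
by congr agree; apply/funext => x; rewrite mulr0 addr0.
Qed.

Lemma agree_lim (f_ : nat -> R -> R) (f : R -> R) (M : R) : (forall n, agree (f_ n)) ->
  (forall n x, 0 < x < t -> `|f_ n x| <= M) ->
  measurable_fun [set: R] f ->
  (forall x, 0 < x < t -> (fun n => f_ n x) @ \oo --> f x) -> agree f.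
Proof.
move=> af fM mf cf; exists M.
have dc (m : {measure set R -> \bar R}) : m setT = 1%E ->
    (fun n => \int[m]_(x in D) (f_ n x)%:E)%E @ \oo -->
    (\int[m]_(x in D) (f x)%:E)%E.
  move=> mT; have [] // := @dominated_convergence _ _ _ m D mD
    (fun n x => (f_ n x)%:E) (fun x => (f x)%:E) (cst M%:E).
  - by move=> n; have [N [mfn _ _]] := af n; exact/measurable_EFinP/measurable_funTS.
  - exact/measurable_EFinP/measurable_funTS.
  - apply: aeW => x; rewrite /D/= in_itv/= => x0t.
    by apply: cvg_EFin; [exact: nearW|exact: cf].
  - have := @measurable_bounded_integrable _ _ _ m (cst M) D mD (mDoo mT).
    apply; first exact: measurable_cst.
    exact: bounded_cst.
  - apply: aeW => x n; rewrite /D/= in_itv/= => x0t.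
    by rewrite lee_fin; exact: fM.
split=> // [x x0t|].
  have cn : (fun n => `|f_ n x|) @ \oo --> `|f x| by exact: cvg_norm (cf x x0t).
  rewrite -(cvg_lim _ cn)//; apply: limr_le.
    by apply/cvg_ex; eexists; exact: cn.
  by apply: nearW => n; exact: fM.
apply: (cvg_unique _ (dc m1 m1T)); first exact: ereal_hausdorff.
rewrite (_ : (fun n => _) = (fun n => \int[m2]_(x in D) (f_ n x)%:E)%E).
  exact: dc.
by apply/funext => n; have [N []] := af n.
Qed.

Hypothesis agree_pj : forall j,
  (\int[m1]_(y in D) (pj j y)%:E = \int[m2]_(y in D) (pj j y)%:E)%E.

Let agree_pj' j : agree (pj j).
Proof.
exists 1; split => //; first exact: measurable_pj.
by move=> x /andP[x0 _]; rewrite ger0_norm ?pj_le1 ?pj_ge0// ltW.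
Qed.

Lemma continuous_laguerre n : continuous (@laguerre R n).
Proof.
move=> x; rewrite /laguerre.
apply: cvg_big => [|i _]; first exact: add_continuous.
by apply: cvgM; [exact: cvg_cst|exact: exprn_continuous].
Qed.

Lemma agree_laguerre n : agree (fun x => expR (- x) * laguerre n x).
Proof.
apply: (@agree_lim (fun J x => \sum_(j < J) (- n%:R) ^+ j * pj j x) _
  (2 * expR (n.+1%:R * t) + 2 * expR (n.+1%:R * t))).
- by move=> J; apply: agree_sum => j; exact: agreeZ.
- move=> J x /andP[/ltW x0 /ltW xt].
  have le_t : 2 * expR (n.+1%:R * x) <= 2 * expR (n.+1%:R * t).
    by rewrite ler_wpM2l// ler_expR ler_wpM2l.
  rewrite -[X in `|X|](subrK (expR (- x) * laguerre n x)).
  rewrite (le_trans (ler_normD _ _))// lerD// (le_trans _ le_t)//.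
    exact: norm_alternating_pj.
  (* The empty sum, [J = 0], bounds the Laguerre term itself. *)
  by have := norm_alternating_pj n 0 x0; rewrite big_ord0 sub0r normrN.
- apply: measurable_funM; apply: continuous_measurable_fun.
    exact: continuous_expRN.
  exact: continuous_laguerre.
- by move=> x /andP[/ltW x0 _]; exact: cvg_alternating_pj.
Qed.

(** [laguerre n] has degree [n] and nonzero leading coefficient, so [x^n] is solved from it and the
    lower powers. *)
Lemma agree_monomial n : agree (fun x => expR (- x) * x ^+ n).
Proof.
elim/ltn_ind: n => n IH.
pose c k : R := rising_neg n k / (k`!%:R * k`!%:R).
have cn0 : c n != 0.
  by rewrite mulf_neq0 ?rising_neg_neq0// invr_eq0 mulf_neq0// pnatr_eq0 -lt0n fact_gt0.
have := agree_linear (c n)^-1 (- (c n)^-1) (agree_laguerre n)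
  (agree_sum (fun i : 'I_n => agreeZ (c i) (IH i (ltn_ord i)))).
congr agree; apply/funext => x.
rewrite (_ : expR (- x) * laguerre n x =
    \sum_(i < n) c i * (expR (- x) * x ^+ i) + c n * (expR (- x) * x ^+ n)).
  by move: (\sum_(i < n) _) (c n) cn0 => S k k0; field.
rewrite /laguerre big_ord_recr/= mulrDr mulr_sumr mulrCA; congr (_ + _).
by apply: eq_bigr => i _; rewrite mulrCA.
Qed.

Lemma agree_poly (p : {poly R}) : agree (fun x => expR (- x) * p.[x]).
Proof.
have := agree_sum (fun i : 'I_(size p) => agreeZ p`_i (agree_monomial i)).
congr agree; apply/funext => x; rewrite horner_coef mulr_sumr.
by apply: eq_bigr => i _; rewrite mulrCA.
Qed.

(** The truncated exponential series in [p n] cancels the weight [e^-x] in the limit, and the power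
    of [1 - (x/t)^n] tends to the indicator of [x/t < a/t]. That power and the weighted truncation
    both stay in [[0,1]], whence the bound 1. *)
Lemma agree_indic (a : R) : 0 < a < t -> agree (fun x => (x < a)%R%:R).
Proof.
move=> /andP[a0 at_].
pose p n : {poly R} := (\poly_(k < n) (k`!%:R)^-1) *
  (1 - (t^-1 *: 'X) ^+ n) ^+ threshold_exponent (a / t) n.
have pE n x : expR (- x) * (p n).[x] = (expR (- x) * series (exp_coeff x) n) *
    (1 - (x / t) ^+ n) ^+ threshold_exponent (a / t) n.
  rewrite -mulrA; congr (_ * _); rewrite /p hornerM; congr (_ * _).
    rewrite horner_poly /series/= big_mkord; apply: eq_bigr => i _.
    by rewrite /exp_coeff/= mulrC.
  by rewrite !hornerE mulrC.
apply: (@agree_lim (fun n x => expR (- x) * (p n).[x]) _ 1).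
- by move=> n; exact: agree_poly.
- move=> n x /andP[x0 xt]; rewrite pE.
  have s0 : 0 <= series (exp_coeff x) n.
    by rewrite sumr_ge0// => i _; rewrite /exp_coeff/= divr_ge0// exprn_ge0// ltW.
  have u0 : 0 <= x / t by rewrite divr_ge0 ?ltW.
  have u1 : x / t <= 1 by rewrite ler_pdivrMr// mul1r ltW.
  have v0 : 0 <= 1 - (x / t) ^+ n by rewrite subr_ge0 exprn_ile1.
  rewrite ger0_norm ?mulr_ge0 ?expR_ge0 ?exprn_ge0//.
  rewrite mulr_ile1 ?mulr_ge0 ?expR_ge0 ?exprn_ge0//.
    rewrite expRN mulrC ler_pdivrMr ?expR_gt0// mul1r.
    have := @nondecreasing_cvgn_le _ (series (exp_coeff x)) _
      (is_cvg_series_exp_coeff x) n.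
    apply; apply/nondecreasing_seqP => m.
    by rewrite /series/= big_nat_recr//= lerDl divr_ge0// exprn_ge0// ltW.
  by rewrite exprn_ile1// gerBl exprn_ge0.
- rewrite (_ : (fun x => _) = \1_(`]-oo, a[%classic : set R)).
    exact: measurable_indic.
  by apply/funext => x; rewrite indicE mem_setE in_itv.
- move=> x /andP[x0 xt].
  rewrite (_ : (fun n => _) = (fun n => (expR (- x) * series (exp_coeff x) n) *
    (1 - (x / t) ^+ n) ^+ threshold_exponent (a / t) n)); last first.
    by apply/funext => n; exact: pE.
  have -> : (x < a)%R%:R = expR (- x) * expR x * (x / t < a / t)%R%:R :> R.
    by rewrite -expRD addNr expR0 mul1r ltr_pM2r// invr_gt0.
  apply: cvgM.
    by apply: cvgM; [exact: cvg_cst|exact: is_cvg_series_exp_coeff].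
  by apply: cvg_threshold; rewrite divr_gt0//= ltr_pdivrMr// mul1r.
Qed.

Lemma eq_measure_initial (a : R) : 0 < a < t ->
  m1 `]0, a[%classic = m2 `]0, a[%classic.
Proof.
move=> a0t; have [M [_ _]] := agree_indic a0t.
have E (m : {measure set R -> \bar R}) :
    (\int[m]_(x in D) ((x < a)%R%:R)%:E)%E = m `]0, a[%classic.
  rewrite -[RHS](_ : m (`]-oo, a[%classic `&` D) = _); last first.
    congr (m _); apply/seteqP; split=> x; rewrite /D/= !in_itv/=.
      by move=> [xa /andP[x0 _]]; rewrite x0.
    move=> /andP[x0 xa]; split=> //; rewrite x0 (lt_trans xa)//.
    by case/andP: a0t.
  rewrite -integral_indic//; apply: eq_integral => x _.
  by rewrite indicE mem_setE in_itv.
by rewrite !E.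
Qed.

End count_moments.

(** * From initial intervals to all Borel sets *)

Section uniqueness.
Context {R : realType}.

Lemma measure_setI_full (m : {measure set R -> \bar R}) (A B : set R) :
  m setT = 1%E -> measurable A -> measurable B -> m B = 1%E ->
  m A = m (A `&` B).
Proof.
move=> mT mA mB B1; rewrite -[in LHS](setIT A) -[in RHS](setIT (A `&` B)).
rewrite -!integral_indic//; last exact: measurableI.
apply: (integral_eq_full mT mB B1).
- exact/measurable_EFinP/measurable_indic.
- by apply/measurable_EFinP/measurable_indic; exact: measurableI.
- by move=> x Bx; rewrite !indicE in_setI (mem_set Bx) andbT.
Qed.

(** The half-lines []-oo, a[] generate the Borel sets and are stable under intersection. Within
    [[0,t)] each leaves nothing, everything, or [{0}] together with [(0,a)]. *)
Lemma eq_measure_of_counts (m1 m2 : {measure set R -> \bar R}) (t : R) :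
  m1 setT = 1%E -> m2 setT = 1%E -> 0 < t ->
  m1 [set x : R | 0 <= x < t] = 1%E -> m2 [set x : R | 0 <= x < t] = 1%E ->
  m1 [set 0] = m2 [set 0] ->
  (forall j, \int[m1]_(y in `]0%R, t[) (pj j y)%:E =
             \int[m2]_(y in `]0%R, t[) (pj j y)%:E)%E ->
  forall A : set R, measurable A -> m1 A = m2 A.
Proof.
move=> m1T m2T t0 m1t m2t m0 mpj.
set B := [set x : R | _] in m1t m2t.
have mB : measurable B.
  rewrite (_ : B = [set` `[0%R, t[]); first exact: measurable_itv.
  by apply/seteqP; split => x; rewrite /B/= in_itv.
pose g (n : nat) : set R := `]-oo, n%:R[%classic.
apply: (measure_unique (@RGenInftyO.G R) g).
- exact: RGenInftyO.measurableE.
- move=> _ _ [a ->] [b ->]; exists (Num.min a b).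
  by apply/seteqP; split => x /=; rewrite !in_itv/= lt_min => /andP.
- by move=> n; exists n%:R.
- apply/seteqP; split => // x _; exists (Num.truncn x).+1 => //.
  by rewrite /g/= in_itv/= truncnS_gt.
- move=> _ [a ->]; set A := `]-oo, a[%classic.
  have mA : measurable A by exact: measurable_itv.
  rewrite (measure_setI_full m1T mA mB m1t) (measure_setI_full m2T mA mB m2t).
  have [a0|a0] := leP a 0.
    rewrite (_ : A `&` B = set0) ?measure0//.
    rewrite -subset0 => x [] /=; rewrite /A/= in_itv/= => xa /andP[x0 _].
    by have := lt_le_trans xa a0; rewrite ltNge x0.
  have [ta|at_] := leP t a.
    rewrite (_ : A `&` B = B) ?m1t ?m2t//; apply: setIidr => x /andP[_ xt].
    by rewrite /A/= in_itv/= (lt_le_trans xt).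
  rewrite (_ : A `&` B = [set 0] `|` `]0, a[%classic); last first.
    apply/seteqP; split => x; rewrite /A/B/= !in_itv/=.
      move=> [xa /andP[]]; rewrite le_eqVlt => /predU1P[<-|->]; first by left.
      by right.
    move=> [->|/andP[x0 xa]]; first by rewrite a0 lexx t0.
    by rewrite xa (ltW x0) (lt_trans xa).
  have dis : [set (0 : R)] `&` `]0, a[%classic = set0.
    by rewrite -subset0 => x [-> /=]; rewrite in_itv/= ltxx.
  rewrite !measureU//; congr (_ + _)%E => //.
  by apply: (eq_measure_initial m1T m2T t0 mpj); rewrite a0.
- move=> n; apply: (@le_lt_trans _ _ (m1 setT)).
    by apply: le_measure; rewrite ?inE//; exact: measurable_itv.
  by rewrite m1T ltry.
Qed.

Lemma count_law_unique (mu nu : R.-pker R ~> R) :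
  good_kernel mu -> count_law mu -> good_kernel nu -> count_law nu ->
  forall t : R, 0 <= t -> forall A : set R, measurable A -> mu t A = nu t A.
Proof.
move=> gmu /(count_lawP gmu) cmu gnu /(count_lawP gnu) cnu t.
have muT s : mu s setT = 1%E by exact: prob_kernel.
have nuT s : nu s setT = 1%E by exact: prob_kernel.
rewrite le_eqVlt => /predU1P[<- A mA|t0].
  (* At [t = 0] both laws are the point mass at 0; the count equations concern only [t > 0]. *)
  rewrite (measure_setI_full (muT 0) mA (measurable_set1 0) gmu.1).
  rewrite (measure_setI_full (nuT 0) mA (measurable_set1 0) gnu.1).
  have [A0|A0] := pselect (A 0).
    by rewrite (_ : A `&` [set 0] = [set 0]) ?gmu.1 ?gnu.1//; apply: setIidr => x ->.
  rewrite (_ : A `&` [set 0] = set0) ?measure0//.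
  by rewrite -subset0 => x [+ /= x0]; rewrite x0.
apply: (eq_measure_of_counts (muT t) (nuT t) t0 (gmu.2 t t0) (gnu.2 t t0)).
  by rewrite (cmu t t0).1 (cnu t t0).1.
by move=> j; rewrite (cmu t t0).2 (cnu t t0).2.
Qed.

End uniqueness.

(* Kernels on [0,oo) are represented as probability kernels on R; only their
   values at states t >= 0 matter, so uniqueness is asserted for t >= 0. *)
Theorem theorem2 (R : realType) :
  (exists mu : R.-pker R ~> R, good_kernel mu /\ count_law mu) /\
  (forall mu nu : R.-pker R ~> R,
     good_kernel mu -> count_law mu -> good_kernel nu -> count_law nu ->
     forall t : R, 0 <= t -> forall A : set R, measurable A ->
       mu t A = nu t A).
Proof.
split; last exact: count_law_unique.
exists (@next_kernel R); split; first exact: next_kernel_good.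
exact: next_kernel_count_law.
Qed.
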